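(* Let $k$ be a field and let $A$ be a finite-dimensional $k$-algebra. If $A$ is both multiserial and quasi-biserial, then $A$ is biserial.
   Context: Modules are finitely generated. An indecomposable module is uniserial if it has only one composition series. $\mathrm{rad}^m(M)$ denotes the $m$-th radical power of $M$. An indecomposable left (resp. right) $A$-module $M$ is biserial if it is not uniserial and there are uniserial left (resp. right) modules (submodules of $M$) $U,V$ with $\mathrm{rad}(M)=U+V$ and $U\cap V$ zero or simple. $A$ is biserial if every indecomposable projective left or right $A$-module is uniserial or biserial. An indecomposable left (resp. right) $A$-module $M$ is multiserial if $\mathrm{rad}(M)$ is a sum of uniserial left (resp. right) modules $U_1,\dots,U_n$ such that $U_i\cap U_j$ is zero or simple whenever $i\ne j$. $A$ is multiserial if every indecomposable projective left or right $A$-module is multiserial. An indecomposable left (resp. right) $A$-module $M$ is quasi-biserial if it is not uniserial and there exist a positive integer $m$ and uniserial left (resp. right) modules $U,V$ such that $\mathrm{rad}^m(M)=U+V$ and $M/\mathrm{rad}^m(M)$ is uniserial. $A$ is quasi-biserial if every indecomposable projective left or right $A$-module is uniserial or quasi-biserial. *)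

(* Defs.v *)
From HB Require Import structures.
From mathcomp Require Import all_boot all_order all_algebra all_field.
From mathcomp Require Import boolp classical_sets.

Set Implicit Arguments.
Unset Strict Implicit.
Unset Printing Implicit Defensive.

Import GRing.Theory.
Local Open Scope classical_set_scope.
Local Open Scope ring_scope.

(* A left R-module is an [lmodType R]; a right R-module is an [lmodType R^c],
   where [R^c] is the opposite ring. *)

Record submodule (R : pzRingType) (M : lmodType R) := Submodule {
  submodule_set :> set M;
  submoduleP : GRing.submod_closed [in submodule_set] }.

Section SubmoduleOperations.
Variables (R : pzRingType) (M : lmodType R).
Implicit Types (N U V : submodule M).

Lemma zerosub_subproof : GRing.submod_closed [in [set (0 : M)]].
Proof.
split=> [|a u v]; rewrite !inE //= => -> ->.
by rewrite scaler0 addr0.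
Qed.
Definition zerosub : submodule M := Submodule zerosub_subproof.

Lemma fullsub_subproof : GRing.submod_closed [in [set: M]].
Proof. by split=> [|a u v _ _]; rewrite inE. Qed.
Definition fullsub : submodule M := Submodule fullsub_subproof.

Lemma addsub_subproof U V :
  GRing.submod_closed [in [set u + v | u in U & v in V]].
Proof.
have [[U0 UP] [V0 VP]] := (submoduleP U, submoduleP V).
split=> [|a x y]; rewrite !inE /=.
  by exists 0; [rewrite inE in U0 | exists 0; [rewrite inE in V0 | rewrite addr0]].
move=> [u Uu [v Vv <-]] [u' Uu' [v' Vv' <-]].
exists (a *: u + u'); first by have := UP a u u'; rewrite !inE; apply.
exists (a *: v + v'); first by have := VP a v v'; rewrite !inE; apply.
by rewrite scalerDr addrACA.
Qed.
Definition addsub U V : submodule M := Submodule (addsub_subproof U V).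

(* [N] is a maximal (proper) submodule of [U]; equivalently [U / N] is
   simple. *)
Definition maximal_in N U : Prop :=
  N `<` U /\
  forall L : submodule M, N `<=` L -> L `<=` U ->
    L = N :> set M \/ L = U :> set M.

Definition simple_set (S : set M) : Prop :=
  exists2 U : submodule M, U = S :> set M & maximal_in zerosub U.

(* Intersection of the maximal submodules of [U] (all of [U] if there are
   none). *)
Definition radset U : set M :=
  U `&` \bigcap_(N in [set N : submodule M | maximal_in N U]) (N : set M).

Lemma radsub_subproof U : GRing.submod_closed [in radset U].
Proof.
have [U0 UP] := submoduleP U.
split=> [|a x y]; rewrite !inE /radset /=.
  split=> [|N _]; first by rewrite inE in U0.
  by have [] := submoduleP N; rewrite inE.
move=> [Ux Nx] [Uy Ny]; split=> [|N NU].
  by have := UP a x y; rewrite !inE; apply.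
have [_ NP] := submoduleP N; have := NP a x y; rewrite !inE; apply.
  exact: Nx.
exact: Ny.
Qed.
Definition radsub U : submodule M := Submodule (radsub_subproof U).

(* rad^m(M), with rad^0(M) = M and rad^(m+1)(M) = rad(rad^m(M)). *)
Definition radpow (m : nat) : submodule M := iter m radsub fullsub.

(* In the next three definitions a submodule [U] of [M] is regarded as a module
   in its own right: its submodules are the submodules of [M] contained in [U].
   The module [M] itself is [fullsub M]. *)
Definition indecomposable U : Prop :=
  U <> [set 0] :> set M /\
  forall V W : submodule M,
    addsub V W = U :> set M -> V `&` W = [set 0] ->
    V = [set 0] :> set M \/ W = [set 0] :> set M.

(* 0 = s_0 < s_1 < ... < s_n = U with s_i maximal in s_(i+1); following the
   convention of [path], the initial term 0 is not stored in [s]. *)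
Definition composition_series U (s : seq (submodule M)) : Prop :=
  path (fun N L => `[< maximal_in N L >]) zerosub s /\
  last zerosub s = U.

Definition uniserial U : Prop :=
  indecomposable U /\ exists! s, composition_series U s.

End SubmoduleOperations.

Arguments zerosub {R M}.
Arguments fullsub {R} M.
Arguments radpow {R} M m.

Section QuotientModule.
Variables (R : pzRingType) (M : lmodType R) (N : submodule M).

Definition submodule_pred : {pred M} := [in (N : set M)].
HB.instance Definition _ :=
  GRing.isSubmodClosed.Build R M submodule_pred (submoduleP N).

Definition quotmod : Type := Quotient.quot submodule_pred.
HB.instance Definition _ := GRing.Zmodule.on quotmod.

Local Open Scope quotient_scope.

Definition quotmod_pi (x : M) : quotmod := \pi_(Quotient.quot submodule_pred) x.

Definition quotmod_scale (a : R) (x : quotmod) : quotmod :=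
  quotmod_pi (a *: repr (x : Quotient.quot submodule_pred)).

Lemma quotmod_piP (x : quotmod) : exists y, x = quotmod_pi y.
Proof. by exists (repr (x : Quotient.quot submodule_pred)); rewrite /quotmod_pi reprK. Qed.

Lemma quotmod_pi_eq x y : quotmod_pi x = quotmod_pi y <-> (N : set M) (x - y).
Proof.
rewrite /quotmod_pi; split.
  by move/eqP; rewrite -Quotient.idealrBE => /set_mem.
by move=> Nxy; apply/eqP; rewrite -Quotient.idealrBE; apply: mem_set.
Qed.

Lemma quotmod_piD x y : quotmod_pi (x + y) = quotmod_pi x + quotmod_pi y.
Proof. exact: (raddfD \pi_(Quotient.quot submodule_pred)). Qed.

Lemma quotmod_piZ a x : quotmod_scale a (quotmod_pi x) = quotmod_pi (a *: x).
Proof.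
rewrite /quotmod_scale; apply/quotmod_pi_eq; rewrite -scalerBr.
apply: (@set_mem _ (N : set M)).
apply: (rpredZ (s := submodule_pred)); apply: mem_set; apply/quotmod_pi_eq.
by rewrite /quotmod_pi reprK.
Qed.

Lemma quotmod_scaleA a b x :
  quotmod_scale a (quotmod_scale b x) = quotmod_scale (a * b) x.
Proof. by have [y ->] := quotmod_piP x; rewrite !quotmod_piZ scalerA. Qed.

Lemma quotmod_scale1 : left_id 1 quotmod_scale.
Proof. by move=> x; have [y ->] := quotmod_piP x; rewrite quotmod_piZ scale1r. Qed.

Lemma quotmod_scaleDr : right_distributive quotmod_scale +%R.
Proof.
move=> a x y; have [[u ->] [v ->]] := (quotmod_piP x, quotmod_piP y).
by rewrite -quotmod_piD !quotmod_piZ scalerDr quotmod_piD.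
Qed.

Lemma quotmod_scaleDl x : {morph quotmod_scale^~ x : a b / a + b}.
Proof.
move=> a b; have [y ->] := quotmod_piP x.
by rewrite !quotmod_piZ scalerDl quotmod_piD.
Qed.

HB.instance Definition _ := GRing.Zmodule_isLmodule.Build R quotmod
  quotmod_scaleA quotmod_scale1 quotmod_scaleDr quotmod_scaleDl.

End QuotientModule.

Section ModuleClasses.
Variable R : pzRingType.
Implicit Type M : lmodType R.

Definition finitely_generated M : Prop :=
  exists (n : nat) (g : 'I_n -> M),
    forall x, exists c : 'I_n -> R, x = \sum_(i < n) c i *: g i.

Definition projective M : Prop :=
  forall (X Y : lmodType R) (p : {linear X -> Y}) (f : {linear M -> Y}),
    (forall y, exists x, p x = y) ->
    exists h : {linear M -> X}, forall m, p (h m) = f m.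

Definition indecomposable_projective M : Prop :=
  [/\ finitely_generated M, indecomposable (fullsub M) & projective M].

Definition uniserial_module M : Prop := uniserial (fullsub M).

Definition zero_or_simple M (S : set M) : Prop := S = [set 0] \/ simple_set S.

Definition biserial_module M : Prop :=
  [/\ indecomposable (fullsub M), ~ uniserial_module M &
    exists U V : submodule M,
      [/\ uniserial U, uniserial V,
          radpow M 1 = addsub U V :> set M & zero_or_simple (U `&` V)]].

(* The family of uniserial submodules may be empty (n = 0), as it must be when
   rad(M) = 0, the zero module not being indecomposable. *)
Definition multiserial_module M : Prop :=
  indecomposable (fullsub M) /\
  exists (n : nat) (U : 'I_n -> submodule M),
    [/\ forall i, uniserial (U i),
        radpow M 1 = \big[@addsub R M/zerosub]_(i < n) U i :> set M &
        forall i j, i != j -> zero_or_simple (U i `&` U j)].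

Definition quasi_biserial_module M : Prop :=
  [/\ indecomposable (fullsub M), ~ uniserial_module M &
    exists (m : nat) (U V : submodule M),
      [/\ (0 < m)%N, uniserial U, uniserial V,
          radpow M m = addsub U V :> set M &
          uniserial_module (quotmod (radpow M m))]].

End ModuleClasses.

Section AlgebraClasses.
Variables (k : fieldType) (A : falgType k).

Definition biserial_algebra : Prop :=
  (forall M : lmodType A, indecomposable_projective M ->
     uniserial_module M \/ biserial_module M) /\
  (forall M : lmodType A^c, indecomposable_projective M ->
     uniserial_module M \/ biserial_module M).

Definition multiserial_algebra : Prop :=
  (forall M : lmodType A, indecomposable_projective M ->
     multiserial_module M) /\
  (forall M : lmodType A^c, indecomposable_projective M ->
     multiserial_module M).

Definition quasi_biserial_algebra : Prop :=
  (forall M : lmodType A, indecomposable_projective M ->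
     uniserial_module M \/ quasi_biserial_module M) /\
  (forall M : lmodType A^c, indecomposable_projective M ->
     uniserial_module M \/ quasi_biserial_module M).

End AlgebraClasses.

(* Main.v *)
Require Import Defs.
From HB Require Import structures.
From mathcomp Require Import all_boot all_algebra all_field.
From mathcomp Require Import boolp classical_sets.

(** The argument concerns one module [M] at a time: being both multiserial and
   quasi-biserial makes it biserial.

   Put [N = rad M], which is a sum of uniserial submodules [F i] meeting pairwise
   in zero or simple modules, and let [rad^m M = U + V] be the quasi-biserial
   decomposition. It suffices to write [N] as a sum of at most two of the [F i]:
   if [N = F i + F j] with [i != j], the intersection condition is inherited, and
   if [N = F i], then [N] is the sum of [F i] and its simple socle.

   If [m = 1], then [N = U + V] has a top of length at most two. The exchange
   property ([exchange]) trades [V], then [U], for some [F i] and [F j].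

   If [m >= 2], the submodules of [M] above [rad^m M] form a chain, so one
   [F i + rad^m M] is all of [N]. As [rad^m M] lies in [rad N], Nakayama's
   lemma gives [N = F i]; it is applied to the uniserial summands [U] and [V] of
   [rad^m M], one after the other ([uniserial_nakayama]).

   Everything rests on two facts about a uniserial module [V]. Its submodules form
   a chain ([uniserial_chain]), since by refinement each of them occurs in the
   unique composition series. Hence it has a largest proper submodule [V'], which
   can be dropped from sums covering [V] ([largest_proper_small]). *)

Set Implicit Arguments.
Unset Strict Implicit.
Unset Printing Implicit Defensive.

Import GRing.Theory.
Local Open Scope classical_set_scope.
Local Open Scope ring_scope.

(** * Submodules as a modular lattice *)

(** Equality is decided classically; it gives access to membership in a
   composition series, which is a sequence of submodules. *)
HB.instance Definition _ (R : pzRingType) (M : lmodType R) :=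
  gen_eqMixin (submodule M).

Section SubmoduleLattice.
Variables (R : pzRingType) (M : lmodType R).
Implicit Types (K L N U V W Q S : submodule M).

Lemma submodule_ext U V : U = V :> set M -> U = V.
Proof.
case: U V => [U cU] [V cV] /= eUV; case: _ / eUV cV => cV.
by congr Submodule; apply: Prop_irrelevance.
Qed.

Lemma submodule_anti U V : U `<=` V -> V `<=` U -> U = V.
Proof. by move=> UV VU; apply: submodule_ext; apply/seteqP. Qed.

Lemma submodule0 U : (U : set M) 0.
Proof. by have [] := submoduleP U; rewrite inE. Qed.

Lemma submoduleZD U a x y :
  (U : set M) x -> (U : set M) y -> (U : set M) (a *: x + y).
Proof. by have [_ UP] := submoduleP U; have := UP a x y; rewrite !inE; apply. Qed.

Lemma submoduleD U x y :
  (U : set M) x -> (U : set M) y -> (U : set M) (x + y).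
Proof. by move=> Ux Uy; rewrite -[x]scale1r; apply: submoduleZD. Qed.

Lemma submoduleB U x y :
  (U : set M) x -> (U : set M) y -> (U : set M) (x - y).
Proof. by move=> Ux Uy; rewrite addrC -scaleN1r; apply: submoduleZD. Qed.

Lemma zerosub_le U : zerosub `<=` U.
Proof. by move=> x /= ->; apply: submodule0. Qed.

Lemma capsub_subproof U V : GRing.submod_closed [in U `&` V].
Proof.
split=> [|a x y]; rewrite !inE; first by split; apply: submodule0.
by move=> [Ux Vx] [Uy Vy]; split; apply: submoduleZD.
Qed.
Definition capsub U V : submodule M := Submodule (capsub_subproof U V).

Lemma le_addsubl U V : U `<=` addsub U V.
Proof. by move=> x Ux; exists x => //; exists 0; rewrite ?addr0 //; apply: submodule0. Qed.

Lemma le_addsubr U V : V `<=` addsub U V.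
Proof. by move=> x Vx; exists 0; [apply: submodule0 | exists x; rewrite ?add0r]. Qed.

Lemma addsub_le U V W : U `<=` W -> V `<=` W -> addsub U V `<=` W.
Proof. by move=> UW VW _ [u /UW Wu [v /VW Wv <-]]; apply: submoduleD. Qed.

Lemma addsubS U U' V V' : U `<=` U' -> V `<=` V' -> addsub U V `<=` addsub U' V'.
Proof.
move=> UU' VV'; apply: addsub_le.
  exact: subset_trans UU' (@le_addsubl _ _).
exact: subset_trans VV' (@le_addsubr _ _).
Qed.

Lemma addsubC U V : addsub U V = addsub V U.
Proof.
by apply: submodule_anti; apply: addsub_le; do ?[exact: le_addsubl | exact: le_addsubr].
Qed.

Lemma addsubA U V W : addsub U (addsub V W) = addsub (addsub U V) W.
Proof.
apply: submodule_ext; apply/seteqP; split=> x /=.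
  case=> u Uu [_ [v Vv [w Ww <-]] <-].
  by exists (u + v); [exists u => //; exists v | exists w; rewrite ?addrA].
case=> _ [u Uu [v Vv <-]] [w Ww <-].
by exists u => //; exists (v + w); [exists v => //; exists w | rewrite addrA].
Qed.

Lemma addsub_idr U V : U `<=` V -> addsub U V = V.
Proof.
by move=> UV; apply: submodule_anti; [apply: addsub_le | apply: le_addsubr].
Qed.

Lemma addsubid U : addsub U U = U.
Proof. exact: addsub_idr. Qed.

Lemma add0sub U : addsub zerosub U = U.
Proof. exact: addsub_idr (@zerosub_le U). Qed.

(** The nontrivial inclusion of the modular law. *)
Lemma modular_le U V W : U `<=` W -> W `&` addsub U V `<=` addsub U (capsub W V).
Proof.
move=> UW x [Wx [u Uu [v Vv ex]]]; exists u => //; exists v => //; split=> //.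
have -> : v = u + v - u by rewrite addrAC subrr add0r.
by apply: submoduleB; [rewrite ex | apply: UW].
Qed.

Lemma zerosub_minimal U : U `<=` zerosub -> U = zerosub.
Proof. by move=> U0; apply: submodule_anti => //; apply: zerosub_le. Qed.

Section FiniteSums.
Variables (I : eqType) (F : I -> submodule M).

Lemma le_bigaddsub (r : seq I) i :
  i \in r -> F i `<=` \big[@addsub R M/zerosub]_(j <- r) F j.
Proof.
elim: r => [//|j r IHr]; rewrite in_cons big_cons => /orP[/eqP <-|/IHr Fi].
  exact: le_addsubl.
exact: subset_trans Fi (@le_addsubr _ _).
Qed.

Lemma bigaddsub_le (r : seq I) K :
  (forall i, F i `<=` K) -> \big[@addsub R M/zerosub]_(j <- r) F j `<=` K.
Proof.
move=> FK; elim: r => [|j r IHr]; first by rewrite big_nil; apply: zerosub_le.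
by rewrite big_cons; apply: addsub_le.
Qed.

(** In a chain a finite sum is its largest term; here the chain consists of
   submodules modulo [Q], and the first alternative is the empty sum. *)
Lemma bigaddsub_chain (r : seq I) Q :
  (forall i j, F i `<=` addsub (F j) Q \/ F j `<=` addsub (F i) Q) ->
  \big[@addsub R M/zerosub]_(j <- r) F j `<=` Q \/
  exists i, \big[@addsub R M/zerosub]_(j <- r) F j `<=` addsub (F i) Q.
Proof.
move=> chainF; elim: r => [|j r IHr]; first by left; rewrite big_nil; apply: zerosub_le.
right; rewrite big_cons; case: IHr => [rQ|[i ri]].
  by exists j; apply: addsubS.
case: (chainF i j) => [ij|ji]; [exists j | exists i]; apply: addsub_le => //.
  exact: le_addsubl.
apply: subset_trans ri _; apply: addsub_le => //; exact: le_addsubr.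
Qed.

End FiniteSums.

(** * Refinement of composition series *)

(** The quotient [(K :&: L) / (N :&: L)] embeds in the simple module [K / N]. *)
Lemma maximal_in_cap N K L : maximal_in N K ->
  capsub N L = capsub K L \/ maximal_in (capsub N L) (capsub K L).
Proof.
move=> [[NK _] maxN]; have [KN|KN] := pselect (capsub K L `<=` capsub N L).
  by left; apply: submodule_anti => // x [/NK].
right; split=> [|X NX XK]; first by split=> // x [/NK].
have XleK : X `<=` K by move=> x /XK[].
have XleL : X `<=` L by move=> x /XK[].
case: (maxN (addsub X N)) => [|| eqXN | eqXK].
- exact: le_addsubr.
- exact: addsub_le.
- left; apply/seteqP; split=> // x Xx; split; last exact: XleL.
  by rewrite -eqXN; apply: le_addsubl.
right; apply/seteqP; split=> // x [Kx Lx].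
have [] := @modular_le X N L XleL x; first by split=> //; rewrite eqXK.
move=> y Xy [z [Lz Nz] <-]; apply: submoduleD => //.
by apply: NX.
Qed.

(** The quotient [(K + L) / (N + L)] is an image of the simple module [K / N]. *)
Lemma maximal_in_add N K L : maximal_in N K ->
  addsub N L = addsub K L \/ maximal_in (addsub N L) (addsub K L).
Proof.
move=> [[NK _] maxN]; have NLKL : addsub N L `<=` addsub K L by apply: addsubS.
have [KN|KN] := pselect (addsub K L `<=` addsub N L).
  by left; apply: submodule_anti.
right; split=> [|X NX XK]; first by split.
have NX' : N `<=` X := subset_trans (@le_addsubl N L) NX.
have LX : L `<=` X := subset_trans (@le_addsubr N L) NX.
case: (maxN (capsub X K)) => [x Nx| x [] // | eqN | eqK].
- by split; [apply: NX' | apply: NK].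
- left; apply/seteqP; split=> // x Xx.
  have : (addsub L (capsub X K) : set M) x.
    by apply: modular_le => //; split=> //; rewrite addsubC; apply: XK.
  by rewrite (submodule_ext eqN) addsubC.
right; apply/seteqP; split=> //; apply: addsub_le => // x.
by rewrite -eqK => -[].
Qed.

Let max_rel : rel (submodule M) := fun N K => `[< maximal_in N K >].

Lemma series_cap B s L : path max_rel B s ->
  exists t, path max_rel (capsub B L) t /\ last (capsub B L) t = capsub (last B s) L.
Proof.
elim: s B => [|K s IHs] B /=; first by exists [::].
move=> /andP[/asboolP BK /IHs[t [pt lt]]].
case: (maximal_in_cap L BK) => [-> | maxB]; first by exists t.
by exists (capsub K L :: t); split=> //=; rewrite pt andbT; apply/asboolP.
Qed.

Lemma series_add B s L : path max_rel B s ->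
  exists t, path max_rel (addsub B L) t /\ last (addsub B L) t = addsub (last B s) L.
Proof.
elim: s B => [|K s IHs] B /=; first by exists [::].
move=> /andP[/asboolP BK /IHs[t [pt lt]]].
case: (maximal_in_add L BK) => [-> | maxB]; first by exists t.
by exists (addsub K L :: t); split=> //=; rewrite pt andbT; apply/asboolP.
Qed.

(** Intersecting a composition series of [U] with [L] leads from [0] to [L], and
   adding [L] to it leads from [L] to [U]; the concatenation passes through [L]. *)
Lemma series_refine U s L : composition_series U s -> L `<=` U ->
  exists s', composition_series U s' /\ L \in zerosub :: s'.
Proof.
move=> [ps ls] LU.
have [t1 [p1 l1]] := series_cap L ps; have [t2 [p2 l2]] := series_add L ps.
have e0 : capsub zerosub L = zerosub by apply: zerosub_minimal => x [].
have eL : capsub U L = L by apply: submodule_anti => [x []|x Lx] //; split=> //; apply: LU.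
have eU : addsub U L = U by rewrite addsubC addsub_idr.
rewrite e0 ls eL in p1 l1; rewrite add0sub ls eU in p2 l2.
exists (t1 ++ t2); split; last by rewrite -cat_cons mem_cat -l1 mem_last.
by split; rewrite ?cat_path ?last_cat l1 // p1.
Qed.

Lemma series_le B s L : path max_rel B s -> L \in s -> B `<=` L.
Proof.
elim: s B => [//|K s IHs] B /= /andP[/asboolP[[BK _] _] /IHs sK].
by rewrite in_cons => /orP[/eqP -> // | /sK]; apply: subset_trans.
Qed.

Lemma series_chain B s K L : path max_rel B s ->
  K \in B :: s -> L \in B :: s -> K `<=` L \/ L `<=` K.
Proof.
elim: s B => [|N s IHs] B ps; first by rewrite !mem_seq1 => /eqP-> /eqP->; left.
rewrite (in_cons B _ K) => /orP[/eqP -> | Ks].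
  by rewrite in_cons => /orP[/eqP -> | Ls]; left=> //; apply: series_le Ls.
rewrite in_cons => /orP[/eqP -> | Ls]; first by right; apply: series_le Ks.
by apply: IHs Ks Ls; case/andP: ps.
Qed.

(** * Uniserial modules *)

(** Refinement through [K] and through [L] yields the same series, because there
   is only one; so [K] and [L] are both terms of it. *)
Lemma uniserial_chain U K L : uniserial U ->
  K `<=` U -> L `<=` U -> K `<=` L \/ L `<=` K.
Proof.
move=> [_ [s [ss uniq_s]]] KU LU.
have [sK [/uniq_s <- Ks]] := series_refine ss KU.
have [sL [/uniq_s <- Ls]] := series_refine ss LU.
by apply: series_chain Ks Ls; case: ss.
Qed.

Lemma uniserial_neq0 U : uniserial U -> ~ U `<=` zerosub.
Proof. by move=> [[U0 _] _] /zerosub_minimal eU; apply: U0; rewrite eU. Qed.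

Definition largest_proper V' V := V' `<` V /\ forall L, L `<` V -> L `<=` V'.

(** By the chain property, the last but one term of the composition series
   contains every proper submodule. *)
Lemma uniserial_local U : uniserial U -> exists U' : submodule M, largest_proper U' U.
Proof.
move=> uU; have [_ [s [[ps ls] _]]] := uU.
case/lastP: s ps ls => [_ /= U0 | s K].
  by case: (uniserial_neq0 uU); rewrite -U0.
rewrite rcons_path last_rcons => /andP[_ /asboolP maxK] eKU.
rewrite -/(last _ _) {K}eKU in maxK; set U' := last _ _ in maxK.
have [U'U maxU'] := maxK; exists U'; split=> // L [LU nUL].
have [//|U'L] := uniserial_chain uU LU (proj1 U'U).
by case: (maxU' L U'L LU) => [-> //| eLU]; case: nUL; rewrite eLU.
Qed.

(** [V'] is superfluous, even inside a bigger module: if [V] were not in [L], then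
   [L :&: V] would lie in [V'], and so would [V = (L :&: V) + V']. *)
Lemma largest_proper_small V' V L :
  largest_proper V' V -> V `<=` addsub L V' -> V `<=` L.
Proof.
move=> [[V'V nVV'] largeV'] VLV'; apply: contrapT => nVL; apply: nVV' => x Vx.
have capV' : capsub L V `<=` V'.
  by apply: largeV'; split=> [y []|VcapL] //; apply: nVL => y /VcapL[].
have [l Ll [v' V'v' ex]] := VLV' x Vx; rewrite -ex.
apply: submoduleD => //; apply: capV'; split=> //.
have -> : l = x - v' by rewrite -ex addrK.
by apply: submoduleB => //; apply: V'V.
Qed.

(** The quotient [(L + V) / (L + V')] is an image of the simple module [V / V'],
   and it is nonzero because [V'] is superfluous. *)
Lemma maximal_in_addl V' V L : largest_proper V' V -> ~ V `<=` L ->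
  maximal_in (addsub L V') (addsub L V).
Proof.
move=> locV nVL; have [[V'V _] largeV'] := locV.
split=> [|K LV'K KLV].
  split=> [|LV]; first exact: addsubS.
  by apply/nVL/(largest_proper_small locV)/(subset_trans (@le_addsubr L V)).
have LK : L `<=` K := subset_trans (@le_addsubl L V') LV'K.
have [VK|nVK] := pselect (V `<=` K).
  by right; apply/seteqP; split=> //; apply: addsub_le.
left; apply/seteqP; split=> // x Kx.
have [] := modular_le LK (conj Kx (KLV x Kx)) => l Ll [v KVv <-].
exists l => //; exists v => //; apply: (largeV' (capsub K V)) => //.
by split=> [y []|VKV] //; apply: nVK => y /VKV[].
Qed.

(** If [N] is not [U], then [U + V'] is maximal in [N], so some [F i] escapes it.
   For this [i] one has [N = U + F i + V'], from which [V'] can be dropped. *)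
Lemma exchange (I : eqType) (r : seq I) (F : I -> submodule M) N U V :
    uniserial V -> N = addsub U V ->
    N = \big[@addsub R M/zerosub]_(i <- r) F i ->
  N = U \/ exists i, N = addsub U (F i).
Proof.
move=> uV eN eF; have [V' locV] := uniserial_local uV.
have [VU|nVU] := pselect (V `<=` U).
  by left; rewrite eN addsubC addsub_idr.
right; have [[LN nNL] maxL] := maximal_in_addl locV nVU; rewrite -eN in LN nNL maxL.
have [i ri nFi] : exists2 i, i \in r & ~ F i `<=` addsub U V'.
  apply: contrapT => noF; apply: nNL; rewrite {1}eF big_seq.
  elim/big_ind: _ => [|K L|i ri]; [exact: zerosub_le | exact: addsub_le |].
  by apply: contrapT => nFi; apply: noF; exists i.
have FiN : F i `<=` N by rewrite eF; apply: le_bigaddsub.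
have UN : U `<=` N by rewrite eN; apply: le_addsubl.
have UFN : addsub U (F i) `<=` N by apply: addsub_le.
exists i; apply: submodule_anti => //.
have eNF : addsub (addsub U (F i)) V' = N.
  have V'N : V' `<=` N := subset_trans (@le_addsubr U V') LN.
  rewrite -addsubA (addsubC (F i)) addsubA; apply: submodule_ext.
  case: (maxL (addsub (addsub U V') (F i))) => // [||eL].
  - exact: le_addsubl.
  - exact: addsub_le.
  by case: nFi; rewrite -eL; apply: le_addsubr.
rewrite {1}eN; apply: addsub_le; first exact: le_addsubl.
apply: (largest_proper_small locV); rewrite eNF eN; exact: le_addsubr.
Qed.

Lemma radsub_le N : radsub N `<=` N.
Proof. by move=> x []. Qed.

(** If [V] were not in [L], then [L + V'] would be a maximal submodule of [N], so
   it would contain [rad N] and hence [V]; but [V'] is superfluous. *)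
Lemma uniserial_nakayama N L V :
  uniserial V -> V `<=` radsub N -> N = addsub L V -> N = L.
Proof.
move=> uV VN eN; have [V' locV] := uniserial_local uV.
have [VL|nVL] := pselect (V `<=` L).
  by rewrite eN addsubC addsub_idr.
have maxL := maximal_in_addl locV nVL; rewrite -eN in maxL.
case: nVL; apply: (largest_proper_small locV) => x /VN[_]; exact.
Qed.

Lemma radpowSS_le m : radpow M m.+2 `<=` radsub (radpow M 1).
Proof.
elim: m => // m IHm; apply: subset_trans IHm; exact: radsub_le.
Qed.

Lemma simple_uniserial S : maximal_in zerosub S -> uniserial S.
Proof.
move=> maxS; have [[_ nS0] minS] := maxS.
have S0 : S <> [set 0] :> set M by move=> eS; apply: nS0; rewrite eS.
split.
  split=> // V W eVW VW0.
  case: (minS V) => [||-> | eV]; [exact: zerosub_le | | by left |].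
    by move=> x Vx; rewrite -eVW; apply: le_addsubl.
  right; apply/seteqP; split=> [x Wx|]; last exact: zerosub_le.
  by rewrite -VW0; split=> //; rewrite eV -eVW; apply: le_addsubr.
exists [:: S]; split; first by split=> //=; rewrite andbT; apply/asboolP.
case=> [|T [|T' t]] [/= ps ls].
- by case: S0; rewrite -ls.
- by rewrite ls.
case/and3P: ps => /asboolP[[_ nT0] _] /asboolP[[TT' nT'T] _] pt; exfalso.
have T'S : T' `<=` S.
  rewrite -ls; have := mem_last T' t; rewrite in_cons => /orP[/eqP -> //|].
  exact: series_le pt.
case: (minS T) => [||eT|eT]; first exact: zerosub_le.
- exact: subset_trans TT' T'S.
- by apply: nT0; rewrite eT.
by apply: nT'T; rewrite eT.
Qed.

Lemma uniserial_socle U : uniserial U ->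
  exists2 S : submodule M, S `<=` U & maximal_in zerosub S.
Proof.
move=> uU; have [_ [[|S s] [[ps ls] _]]] := uU.
  by case: (uniserial_neq0 uU); rewrite -ls.
case/andP: ps => /asboolP maxS ps; exists S => //; rewrite -ls /=.
have := mem_last S s; rewrite in_cons => /orP[/eqP -> //|].
exact: series_le ps.
Qed.

End SubmoduleLattice.

(** * Submodules of a uniserial quotient *)

Section Quotient.
Variables (R : pzRingType) (M : lmodType R) (Q : submodule M).

Lemma image_subproof (L : submodule M) :
  GRing.submod_closed [in [set quotmod_pi Q x | x in L]].
Proof.
split=> [|a p q]; rewrite !inE /=.
  exists 0; first exact: submodule0.
  by apply: (addrI (quotmod_pi Q 0)); rewrite -quotmod_piD !addr0.
move=> [x Lx <-] [y Ly <-]; exists (a *: x + y); first exact: submoduleZD.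
by rewrite quotmod_piD -quotmod_piZ.
Qed.
Definition image_sub L : submodule (quotmod Q) := Submodule (@image_subproof L).

Lemma uniserial_quot_chain (K L : submodule M) :
  uniserial_module (quotmod Q) -> K `<=` addsub L Q \/ L `<=` addsub K Q.
Proof.
move=> uQ.
have lift (X Y : submodule M) : image_sub X `<=` image_sub Y -> X `<=` addsub Y Q.
  move=> XY x Xx; have [y Yy /esym/quotmod_pi_eq Qxy] : (image_sub Y : set _) (quotmod_pi Q x).
    by apply: XY; exists x.
  by exists y => //; exists (x - y) => //; rewrite addrC subrK.
by case: (@uniserial_chain _ _ _ (image_sub K) (image_sub L) uQ) => // /lift; [left|right].
Qed.

End Quotient.

(** * Multiserial and quasi-biserial modules *)

Section MultiserialQuasiBiserial.
Variables (R : pzRingType) (M : lmodType R).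
Implicit Types (N L U V : submodule M).

(** Exchange [V], then [U]. When the first exchange already gives [N = U],
   exchanging [U] against the zero summand gives [N = F i]; the equality [N = F i]
   is recorded as [i = j]. *)
Lemma sum_two_uniserial (I : eqType) (r : seq I) (F : I -> submodule M) N U V :
    uniserial U -> uniserial V -> N = addsub U V ->
    N = \big[@addsub R M/zerosub]_(i <- r) F i ->
  exists i j, N = addsub (F i) (F j).
Proof.
move=> uU uV eN eF; case: (exchange uV eN eF) => [eNU|[i eNi]].
  case: (exchange uU _ eF (U := zerosub)) => [|N0|[i eNi]].
  - by rewrite add0sub.
  - by case: (uniserial_neq0 uU); rewrite -eNU N0.
  by exists i, i; rewrite addsubid eNi add0sub.
rewrite addsubC in eNi; case: (exchange uU eNi eF) => [eNFi|[j eNj]].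
  by exists i, i; rewrite addsubid.
by exists i, j.
Qed.

(** The exponent [m.+2] puts [rad^(m+2) M = U + V] inside [rad N], which is what
   allows [U] and [V] to be stripped from [N = F i + (U + V)] by Nakayama. *)
Lemma radical_high_power (n : nat) (F : 'I_n -> submodule M) (m : nat) U V :
    uniserial U -> uniserial V -> radpow M m.+2 = addsub U V ->
    uniserial_module (quotmod (radpow M m.+2)) ->
    radpow M 1 = \big[@addsub R M/zerosub]_(i < n) F i ->
  exists i, radpow M 1 = F i.
Proof.
move=> uU uV eUV uQ; set N := radpow M 1 => eF.
have radUV : addsub U V `<=` radsub N by rewrite -eUV; apply: radpowSS_le.
have radN : addsub U V `<=` N := subset_trans radUV (@radsub_le _ _ N).
have cancelUV L : L `<=` N -> N `<=` addsub L (addsub U V) -> N = L.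
  move=> LN NL.
  apply: (uniserial_nakayama uU (subset_trans (@le_addsubl _ _ U V) radUV)).
  apply: (uniserial_nakayama uV (subset_trans (@le_addsubr _ _ U V) radUV)).
  by rewrite -addsubA; apply: submodule_anti => //; apply: addsub_le.
case: (@bigaddsub_chain _ _ _ F (index_enum 'I_n) (radpow M m.+2)).
- by move=> i j; apply: uniserial_quot_chain.
- rewrite -eF eUV => NUV.
  (* The empty sum cannot occur: [L = 0] would give [N = 0], while [U <= N]. *)
  have N0 : N = zerosub.
    by apply: cancelUV; [exact: zerosub_le | rewrite add0sub].
  case: (uniserial_neq0 uU); rewrite -N0.
  exact: subset_trans (@le_addsubl _ _ U V) radN.
move=> [i]; rewrite -eF eUV => NFi; exists i; apply: cancelUV => //.
by rewrite eF; apply: le_bigaddsub; rewrite mem_index_enum.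
Qed.

Lemma multiserial_quasi_biserial :
  multiserial_module M -> quasi_biserial_module M -> biserial_module M.
Proof.
move=> [_ [n [F [uF eF capF]]]] [indM nuM [m [U [V [m_gt0 uU uV eUV uQ]]]]].
have {}eF := submodule_ext eF; have {}eUV := submodule_ext eUV.
have [i [j eN]] : exists i j, radpow M 1 = addsub (F i) (F j).
  case: m m_gt0 eUV uQ => [//|[_ eUV _|m _ eUV uQ]].
    exact: sum_two_uniserial uU uV eUV eF.
  have [i ->] := radical_high_power uU uV eUV uQ eF.
  by exists i, i; rewrite addsubid.
split=> //; rewrite eN; have [<-|neq_ij] := eqVneq i j; last first.
  by exists (F i), (F j); split=> //; apply: capF.
(* A uniserial radical: its socle serves as a redundant second summand. *)
have [S SF minS] := uniserial_socle (uF i).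
exists (F i), S; split=> //; first exact: simple_uniserial.
  by rewrite addsubid addsubC (addsub_idr SF).
by right; exists S => //; rewrite setIidr.
Qed.

End MultiserialQuasiBiserial.

Theorem proposition2p3 (k : fieldType) (A : falgType k) :
  multiserial_algebra A -> quasi_biserial_algebra A -> biserial_algebra A.
Proof.
move=> [multiL multiR] [quasiL quasiR]; split=> M projM.
  by case: (quasiL M projM) => [|/multiserial_quasi_biserial]; [left | right; auto].
by case: (quasiR M projM) => [|/multiserial_quasi_biserial]; [left | right; auto].
Qed.
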